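(* Let $\theta:\mathbb{R}^n\to[-\infty,\infty]$ be a symmetric function and let $X\in\mathbf{S}^n$ with $(\theta\circ\lambda)(X)$ finite. Assume either (i) $\theta$ is lower semicontinuous and convex with $\partial\theta(\lambda(X))\neq\emptyset$, or (ii) $\theta$ is locally Lipschitz continuous around $\lambda(X)$ relative to its domain. Then for all $H\in\mathbf{S}^n$, $$\mathrm{d}(\theta\circ\lambda)(X)(H)=\mathrm{d}\theta(\lambda(X))\big(\lambda'(X;H)\big).$$
   Context: $\mathbf{S}^n$: real symmetric $n\times n$ matrices with trace inner product. $\lambda(X)$: eigenvalue vector in nonincreasing order. $\theta$ symmetric: $\theta(Px)=\theta(x)$ for all permutation matrices $P$. $\partial\theta$ is the convex-analysis subdifferential. Local Lipschitz continuity around $\bar x$ relative to the domain: $\theta(\bar x)$ finite and $|\theta(x)-\theta(y)|\le\ell\|x-y\|$ for all $x,y\in V\cap\mathrm{dom}\,\theta$, $V$ a neighborhood of $\bar x$. Subderivative: $\mathrm{d}f(\bar x)(\bar w)=\liminf_{t\downarrow0,\,w\to\bar w}\frac{f(\bar x+tw)-f(\bar x)}{t}$. If $\mu_1>\dots>\mu_r$ are the distinct eigenvalues of $X$, $\alpha_m=\{i:\lambda_i(X)=\mu_m\}$, $U$ is orthogonal with $X=U\mathrm{Diag}(\lambda(X))U^\top$, and $U_{\alpha_m}$ is the submatrix of $U$ formed by the columns indexed by $\alpha_m$, then the directional derivative $\lambda'(X;H)=\lim_{t\downarrow0}(\lambda(X+tH)-\lambda(X))/t$ exists and equals $\big(\lambda(U_{\alpha_1}^\top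 HU_{\alpha_1}),\dots,\lambda(U_{\alpha_r}^\top HU_{\alpha_r})\big)$. *)

(* Defs.v *)
From HB Require Import structures.
From mathcomp Require Import all_boot all_order all_algebra all_fingroup.
From mathcomp Require Import all_classical all_reals all_analysis.
Set Implicit Arguments. Unset Strict Implicit. Unset Printing Implicit Defensive.
Import Order.TTheory GRing.Theory Num.Theory.
Import numFieldNormedType.Exports.
Local Open Scope classical_set_scope.
Local Open Scope ring_scope.

Section Defs.
Variable R : realType.

Definition symmx n : set 'M[R]_n := [set X | X^T = X].

Definition orthmx n (U : 'M[R]_n) : Prop := U *m U^T = 1%:M.

Definition nonincr n (l : 'rV[R]_n) : Prop :=
  forall i j : 'I_n, (i <= j)%N -> l 0 j <= l 0 i.

(* lambda(X): the eigenvalue vector in nonincreasing order, i.e. the unique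
   nonincreasing l with X = U Diag(l) U^T for some orthogonal U
   (exists and is unique for X symmetric, by the spectral theorem). *)
Definition eigvec n (X : 'M[R]_n) : 'rV[R]_n :=
  xget 0 [set l | nonincr l /\ exists U, orthmx U /\ X = U *m diag_mx l *m U^T].

Definition eigvec_dir n (X H : 'M[R]_n) : 'rV[R]_n :=
  lim ((fun t : R => t^-1 *: (eigvec (X + t *: H) - eigvec X)) @ 0^'+).

Definition symmetric_fun n (theta : 'rV[R]_n -> \bar R) : Prop :=
  forall (s : 'S_n) (x : 'rV[R]_n), theta (col_perm s x) = theta x.

(* convexity of an extended-real-valued function (convex epigraph) *)
Definition econvex n (theta : 'rV[R]_n -> \bar R) : Prop :=
  forall (x y : 'rV[R]_n) (a b t : R), (theta x <= a%:E)%E -> (theta y <= b%:E)%E ->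
    0 <= t <= 1 ->
    (theta (((1 - t) *: x + t *: y)%R) <= ((1 - t) * a + t * b)%R%:E)%E.

Definition elsc n (theta : 'rV[R]_n -> \bar R) : Prop :=
  forall (x : 'rV[R]_n) (a : R), (a%:E < theta x)%E ->
    \forall y \near x, (a%:E < theta y)%E.

Definition dotv n (u v : 'rV[R]_n) : R := \sum_i u 0 i * v 0 i.

Definition subdiff n (theta : 'rV[R]_n -> \bar R) (x : 'rV[R]_n) : set 'rV[R]_n :=
  [set v | forall y, (theta x + (dotv v (y - x)%R)%:E <= theta y)%E].

Definition edom n (theta : 'rV[R]_n -> \bar R) : set 'rV[R]_n :=
  [set x | (theta x < +oo)%E].

Definition loc_lipschitz_rel n (theta : 'rV[R]_n -> \bar R) (xb : 'rV[R]_n) : Prop :=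
  theta xb \is a fin_num /\
  exists (l : R) (V : set 'rV[R]_n), nbhs xb V /\
    forall x y, V x -> V y -> edom theta x -> edom theta y ->
      (`|theta x - theta y| <= (l * `|(x - y)%R|)%R%:E)%E.

(* subderivative of f at x in direction w, for f defined on the set A
   (w' ranges in A): liminf_{t -> 0+, w' -> w} (f(x + t w') - f(x))/t *)
Definition subderiv (V : normedModType R) (A : set V) (f : V -> \bar R)
    (x w : V) : \bar R :=
  ereal_sup [set ereal_inf
     [set y : \bar R | exists (t : R) (w' : V),
        [/\ 0 < t < e, A w', `|w' - w| < e &
             y = ((f (x + t *: w')%R - f x) * (t^-1)%:E)%E]]
     | e in [set e : R | 0 < e]].
End Defs.

(* Main.v *)
Require Import Defs.
From HB Require Import structures.
From mathcomp Require Import all_boot all_order all_algebra all_fingroup.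
From mathcomp Require Import all_classical all_reals all_analysis.
From mathcomp Require Import complex ring lra zify.
Import Order.TTheory GRing.Theory Num.Theory.
Import numFieldNormedType.Exports.
Local Open Scope classical_set_scope.
Local Open Scope ring_scope.

Set Implicit Arguments. Unset Strict Implicit. Unset Printing Implicit Defensive.

(* Both subderivatives are liminfs of the same difference quotients. If W is
   close to H and t > 0 is small, then v = (lambda(X + t W) - lambda(X)) / t is
   close to lambda'(X; H), because lambda is Lipschitz and directionally
   differentiable. Conversely, if v is close to lambda'(X; H), take an eigenbasis
   U of X + t H and define W by X + t W = U Diag(lambda(X) + t v) U^T: then
   W - H = U Diag(v - (lambda(X + t H) - lambda(X)) / t) U^T is small, and theta
   takes the same value at lambda(X + t W) and at lambda(X) + t v by symmetry.
   The properties of lambda come from Ky Fan's principle: the sum of the k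
   largest eigenvalues is a maximum of linear functions of the matrix, hence it is
   convex and Lipschitz, and so it has one-sided directional derivatives. *)

(** * Spectral theorem for real symmetric matrices *)

Section SpectralTheorem.
Variable R : realType.

Lemma dotmx_ge0 n (u : 'rV[R]_n) : 0 <= (u *m u^T) 0 0.
Proof. by rewrite mxE; apply: sumr_ge0 => i _; rewrite mxE -expr2 sqr_ge0. Qed.

Lemma dotmx_eq0 n (u : 'rV[R]_n) : (u *m u^T) 0 0 = 0 -> u = 0.
Proof.
rewrite mxE => /eqP; rewrite psumr_eq0 => [/allP u0|i _]; last first.
  by rewrite mxE -expr2 sqr_ge0.
apply/rowP => i; rewrite mxE; apply/eqP.
by have := u0 i (mem_index_enum _); rewrite mxE mulf_eq0 orbb.
Qed.

Lemma orthmxC n (U : 'M[R]_n) : orthmx U -> U^T *m U = 1%:M.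
Proof. by move=> /mulmx1C. Qed.

Lemma orthmx_tr n (U : 'M[R]_n) : orthmx U -> orthmx U^T.
Proof. by rewrite /orthmx trmxK => /orthmxC. Qed.

Lemma orthmxM n (U V : 'M[R]_n) : orthmx U -> orthmx V -> orthmx (U *m V).
Proof.
by rewrite /orthmx => oU oV; rewrite trmx_mul mulmxA -(mulmxA U) oV mulmx1.
Qed.

(* If (u + i v) A = (a + i b)(u + i v), then computing u A v^T in two ways
   gives b (|u|^2 + |v|^2) = 0. *)
Lemma symmx_eigen n (A : 'M[R]_n.+1) : symmx A ->
  exists a (v : 'rV[R]_n.+1), v *m A = a *: v /\ v *m v^T = 1%:M.
Proof.
rewrite /symmx /= => sA.
suff [a [v [vA v0]]] : exists a (v : 'rV[R]_n.+1), v *m A = a *: v /\ v != 0.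
  have c_gt0 : 0 < (v *m v^T) 0 0.
    rewrite lt_neqAle dotmx_ge0 andbT eq_sym.
    by apply: contraNneq v0 => /dotmx_eq0 ->.
  exists a, ((Num.sqrt ((v *m v^T) 0 0))^-1 *: v); split.
    by rewrite -scalemxAl vA !scalerA mulrC.
  rewrite linearZ/= -scalemxAl -scalemxAr scalerA -invfM -expr2.
  rewrite sqr_sqrtr ?ltW// [X in _ *: X]mx11_scalar.
  by rewrite scale_scalar_mx mulVf// gt_eqF.
(* An eigenvalue exists over the complex numbers; its eigenvector is split into real and imaginary
   parts. *)
have [z /eigenvalueP[w wA w0]] :=
  @eigenvalue_closed _ _ (map_mx (real_complex R) A) (ltn0Sn n).
pose u := map_mx (@complex.Re R) w; pose v := map_mx (@complex.Im R) w.
pose a := complex.Re z; pose b := complex.Im z.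
have uA : u *m A = a *: u - b *: v.
  apply/rowP => j; have /rowP/(_ j)/(congr1 (@complex.Re R)) := wA.
  rewrite !mxE raddf_sum /a /b /=; case: z {wA a b} => a b.
  case: (w 0 j) => [x y] /= <-; apply: eq_bigr => i _.
  by rewrite !mxE; case: (w 0 i) => /= p q; rewrite mulr0 subr0.
have vA : v *m A = a *: v + b *: u.
  apply/rowP => j; have /rowP/(_ j)/(congr1 (@complex.Im R)) := wA.
  rewrite !mxE raddf_sum /a /b /=; case: z {wA a b uA} => a b.
  case: (w 0 j) => [x y] /= <-; apply: eq_bigr => i _.
  by rewrite !mxE; case: (w 0 i) => /= p q; rewrite mulr0 add0r.
have E : (a *: u - b *: v) *m v^T = u *m (a *: v + b *: u)^T.
  by rewrite -uA -vA trmx_mul sA mulmxA.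
have b0 : b * ((u *m u^T) 0 0 + (v *m v^T) 0 0) = 0.
  move/matrixP/(_ 0 0): E; rewrite mulmxDl mulNmx.
  rewrite [(_ + _)^T]linearD/= ![(_ *: _)^T]linearZ/= mulmxDr.
  rewrite -!scalemxAl -!scalemxAr.
  set p := _ *m _; set q := _ *m _; set r := _ *m _; rewrite !mxE; lra.
have uv : (u != 0) || (v != 0).
  apply: contraNT w0; rewrite negb_or !negbK => /andP[/eqP u0 /eqP v0].
  apply/eqP/rowP => j; rewrite mxE.
  have /rowP/(_ j) := u0; have /rowP/(_ j) := v0; rewrite !mxE.
  by case: (w 0 j) => x y /= -> ->.
have {}b0 : b = 0.
  move/eqP: b0; rewrite mulf_eq0 => /orP[/eqP//|].
  rewrite paddr_eq0 ?dotmx_ge0// => /andP[/eqP/dotmx_eq0 u0 /eqP/dotmx_eq0 v0].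
  by move: uv; rewrite u0 v0 eqxx.
rewrite b0 !scale0r subr0 in uA; rewrite b0 !scale0r addr0 in vA.
by case/orP: uv => ?; [exists a, u|exists a, v].
Qed.

(* The Householder reflection in the hyperplane orthogonal to v - e. *)
Lemma orthmx_reflection n (e v : 'rV[R]_n) :
  e *m e^T = 1%:M -> v *m v^T = 1%:M -> exists2 U, orthmx U & e *m U = v.
Proof.
move=> ee vv; have [->|ev] := eqVneq v e.
  by exists 1%:M; rewrite ?mulmx1// /orthmx trmx1 mulmx1.
pose w := v - e; pose c := (w *m w^T) 0 0.
have c0 : c != 0.
  by apply: contraNneq ev => /dotmx_eq0/eqP; rewrite subr_eq0.
have ww : w *m w^T = c%:M by rewrite [LHS]mx11_scalar.
have ev_ve : v *m e^T = e *m v^T.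
  by rewrite -[e in RHS]trmxK -trmx_mul; apply/matrixP => i j; rewrite !ord1 [RHS]mxE.
(* For unit vectors, |v - e|^2 = 2 - 2 <e, v>, while <e, w> = <e, v> - 1. *)
have ew : e *m w^T = (- (c / 2))%:M.
  rewrite [LHS]mx11_scalar; congr (_%:M).
  have E1 : w *m w^T = 1%:M - e *m v^T - e *m v^T + 1%:M.
    by rewrite /w linearB/= mulmxBl !mulmxBr ee vv ev_ve opprB addrA addrAC.
  have E2 : e *m w^T = e *m v^T - 1%:M by rewrite /w linearB/= mulmxBr ee.
  move/matrixP/(_ 0 0): E1; move/matrixP/(_ 0 0): E2; rewrite /c.
  set p := w *m w^T; set q := e *m w^T; set r := e *m v^T.
  by rewrite !mxE /=; lra.
have sP : (w^T *m w)^T = w^T *m w by rewrite trmx_mul trmxK.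
have PP : (w^T *m w) *m (w^T *m w) = c *: (w^T *m w).
  by rewrite mulmxA -(mulmxA w^T) ww mul_mx_scalar -scalemxAl.
have eP : e *m (w^T *m w) = - (c / 2) *: (v - e).
  by rewrite mulmxA ew mul_scalar_mx.
move: (w^T *m w) sP PP eP => P sP PP eP.
exists (1%:M - (2 / c) *: P).
  rewrite /orthmx [(_ - _)^T]linearB/= trmx1 [(_ *: _)^T]linearZ/= sP.
  rewrite mulmxBl mul1mx mulmxBr mulmx1 -scalemxAl -scalemxAr PP !scalerA.
  have -> : 2 / c * (2 / c) * c = 2 / c + 2 / c by field.
  by rewrite scalerDl opprB addrK subrK.
rewrite mulmxBr mulmx1 -scalemxAr eP scalerA.
have -> : 2 / c * - (c / 2) = -1 by field.
by rewrite scaleN1r opprK addrC subrK.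
Qed.

(** Deflation: an orthogonal change of basis sends the first basis vector to a unit eigenvector; by
    symmetry the matrix becomes block diagonal, and induction applies to the lower block. *)
Lemma symmx_spectral n (A : 'M[R]_n) : symmx A ->
  exists (U : 'M[R]_n) l, orthmx U /\ A = U *m diag_mx l *m U^T.
Proof.
rewrite /symmx /=; elim: n A => [A sA|n IH].
  by exists 1%:M, 0; rewrite /orthmx; split; apply/matrixP => -[].
rewrite -[n.+1]/(1 + n)%N => A sA.
have [a [v [vA vv]]] := @symmx_eigen _ A sA.
pose e : 'rV[R]_(1 + n) := row_mx 1%:M 0.
have ee : e *m e^T = 1%:M.
  by rewrite /e tr_row_mx mul_row_col trmx1 trmx0 mulmx0 addr0 mulmx1.
have [U oU eU] := orthmx_reflection ee vv.
pose B : 'M[R]_(1 + n) := U *m A *m U^T.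
have sB : B^T = B by rewrite !trmx_mul trmxK sA mulmxA.
have eB : e *m B = a *: e.
  by rewrite /B !mulmxA eU vA -eU -scalemxAl -mulmxA oU mulmx1.
have [ulB urB] : ulsubmx B = a%:M /\ ursubmx B = 0.
  move: eB; rewrite /e -{1}(submxK B) mul_row_block !mul1mx !mul0mx !addr0.
  rewrite scale_row_mx scaler0 => /eq_row_mx[-> ->].
  by rewrite scale_scalar_mx mulr1.
have dlB : dlsubmx B = 0 by rewrite -sB -trmx_ursub urB trmx0.
have [V [l [oV dB]]] : exists (V : 'M[R]_n) l,
    orthmx V /\ drsubmx B = V *m diag_mx l *m V^T.
  by apply: IH; rewrite trmx_drsub sB.
pose W : 'M[R]_(1 + n) := block_mx 1%:M 0 0 V.
have oW : orthmx W.
  rewrite /orthmx tr_block_mx mulmx_block !trmx0 !trmx1 !mulmx0 !mul0mx.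
  by rewrite !addr0 add0r mulmx1 oV -scalar_mx_block.
exists (U^T *m W), (row_mx a%:M l); split.
  exact: orthmxM (orthmx_tr oU) oW.
rewrite trmx_mul trmxK mulmxA.
have -> : A = U^T *m B *m U.
  by rewrite /B !mulmxA orthmxC// mul1mx -mulmxA orthmxC// mulmx1.
congr (_ *m U); rewrite -!mulmxA; congr (_ *m _).
rewrite -(submxK B) ulB urB dlB dB diag_mx_row tr_block_mx !mulmx_block.
rewrite !trmx0 !trmx1 !mulmx0 !mul0mx !addr0 !add0r !mul1mx !mulmx1 mulmxA.
by rewrite mulmx0; congr block_mx; apply/matrixP => i j; rewrite !mxE !ord1.
Qed.

End SpectralTheorem.

(** * The matrix norm as the largest absolute value of an entry *)

Section MatrixNorm.
Variables (R : realType) (m n : nat).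

Lemma ler_mx_entry (A : 'M[R]_(m, n)) i j : `|A i j| <= `|A|.
Proof.
rewrite [leRHS]/Num.norm /= mx_normrE.
exact: (le_bigmax _ (fun p : 'I_m * 'I_n => `|A p.1 p.2|) (i, j)).
Qed.

Lemma mx_norm_le (A : 'M[R]_(m, n)) c :
  0 <= c -> (forall i j, `|A i j| <= c) -> `|A| <= c.
Proof.
move=> c0 Ac; rewrite [leLHS]/Num.norm /= mx_normrE.
by apply/bigmax_leP; split => // -[i j] _; exact: Ac.
Qed.

End MatrixNorm.

(** * Ky Fan's principle; Lipschitz continuity and uniqueness of the ordered spectrum *)

Section OrderedSpectrum.
Variables (R : realType) (n : nat).
Implicit Types (X Y H U V : 'M[R]_n) (l m : 'rV[R]_n).

Lemma spectral_entry U l i j :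
  (U *m diag_mx l *m U^T) i j = \sum_k U i k * l 0 k * U j k.
Proof. by rewrite mxE; apply: eq_bigr => k _; rewrite mul_mx_diag !mxE. Qed.

Lemma spectral_symmx U l : symmx (U *m diag_mx l *m U^T).
Proof. by rewrite /symmx /= !trmx_mul trmxK tr_diag_mx mulmxA. Qed.

Lemma orthmx_entry U i j : orthmx U -> `|U i j| <= 1.
Proof.
move=> /matrixP/(_ i i); rewrite !mxE eqxx => U1.
rewrite -(@ler_pXn2r _ 2)// ?nnegrE// expr1n real_normK ?num_real//.
rewrite -[leRHS]U1 (bigD1 j)//= mxE -expr2 lerDl.
by apply: sumr_ge0 => k _; rewrite mxE -expr2 sqr_ge0.
Qed.

Lemma nonincr_col_perm l : exists s : 'S_n, nonincr (col_perm s l).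
Proof.
pose t := [tuple l 0 i | i < n].
have [/= s st] : exists s : 'S_n,
    sort >=%R t = [tuple tnth t (s i) | i < n].
  by apply/tuple_permP; rewrite perm_sort.
have ls i : col_perm s l 0 i = nth 0 (sort >=%R t) i.
  by rewrite st mxE nth_mktuple tnth_mktuple.
exists s => i j ij; rewrite !ls.
apply: (@sorted_leq_nth _ >=%R) => //.
- by move=> y x z xy yz; exact: le_trans yz xy.
- by move=> x; exact: lexx.
- by apply: sort_sorted => x y; exact: le_total.
- by rewrite inE size_sort size_tuple ltn_ord.
- by rewrite inE size_sort size_tuple ltn_ord.
Qed.

Lemma spectral_col_perm U l (s : 'S_n) :
  col_perm s U *m diag_mx (col_perm s l) *m (col_perm s U)^T =
  U *m diag_mx l *m U^T.
Proof.
apply/matrixP => i j; rewrite !spectral_entry [RHS](reindex_inj (@perm_inj _ s)).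
by apply: eq_bigr => k _; rewrite !mxE.
Qed.

Lemma orthmx_col_perm U (s : 'S_n) : orthmx U -> orthmx (col_perm s U).
Proof.
rewrite /orthmx => <-; apply/matrixP => i j; rewrite !mxE.
rewrite [RHS](reindex_inj (@perm_inj _ s)).
by apply: eq_bigr => k _; rewrite !mxE.
Qed.

Definition partial_sum k l : R := \sum_(i < n | (i < k)%N) l 0 i.

(** For orthogonal [V], the trace of the compression of [X] to the span of the first [k] columns of
    [V]. *)
Definition partial_trace k V X : R :=
  \sum_(i < n | (i < k)%N) (V^T *m X *m V) i i.

Lemma partial_traceD k V X Y :
  partial_trace k V (X + Y) = partial_trace k V X + partial_trace k V Y.
Proof.
rewrite -big_split/=; apply: eq_bigr => i _.
by rewrite mulmxDr mulmxDl mxE.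
Qed.

Lemma partial_traceZ k V t X :
  partial_trace k V (t *: X) = t * partial_trace k V X.
Proof.
rewrite mulr_sumr; apply: eq_bigr => i _.
by rewrite -scalemxAr -scalemxAl mxE.
Qed.

Lemma partial_trace_spectral k V l : orthmx V ->
  partial_trace k V (V *m diag_mx l *m V^T) = partial_sum k l.
Proof.
move=> /orthmxC oV; apply: eq_bigr => i _.
by rewrite !mulmxA oV mul1mx -mulmxA oV mulmx1 mxE eqxx.
Qed.

(** The entry is a sum of n^2 products, each an entry of [X] times two entries of [V], which are at
    most 1 in absolute value. *)
Lemma orthmx_conj_entry V X i j : orthmx V ->
  `|(V *m X *m V^T) i j| <= (n * n)%:R * `|X|.
Proof.
move=> oV; rewrite mxE; apply: le_trans (ler_norm_sum _ _ _) _.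
have -> : (n * n)%:R * `|X| = \sum_(k < n) \sum_(p < n) `|X|.
  by rewrite !sumr_const !card_ord -mulrnA mulr_natl.
apply: ler_sum => k _; rewrite !mxE mulr_suml.
apply: le_trans (ler_norm_sum _ _ _) _; apply: ler_sum => p _.
rewrite !normrM -[leRHS]mul1r -[leRHS]mulr1.
apply: ler_pM; rewrite ?mulr_ge0 ?orthmx_entry//.
by apply: ler_pM; rewrite ?orthmx_entry ?ler_mx_entry.
Qed.

Lemma partial_trace_le k V X : orthmx V ->
  `|partial_trace k V X| <= (n * n * n)%:R * `|X|.
Proof.
move=> oV; apply: le_trans (ler_norm_sum _ _ _) _.
have -> : (n * n * n)%:R * `|X| = \sum_(i < n) (n * n)%:R * `|X|.
  by rewrite sumr_const card_ord -[RHS]mulr_natl natrM mulrA mulrC; ring.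
rewrite big_mkcond; apply: ler_sum => i _; case: ifP => _.
  by have := orthmx_conj_entry X i i (orthmx_tr oV); rewrite trmxK.
by rewrite mulr_ge0.
Qed.

(* The squared entries of the orthogonal matrix V^T U form a doubly stochastic
   matrix, so the left-hand side is a weighted sum of the entries of l with
   weights in [0, 1] of total mass min k n; p separates the k largest entries
   of l from the others. *)
Lemma ky_fan k U V l : orthmx U -> orthmx V -> nonincr l ->
  partial_trace k V (U *m diag_mx l *m U^T) <= partial_sum k l.
Proof.
move=> oU oV ll.
have [M oM ->] : exists2 M : 'M[R]_n, orthmx M &
    partial_trace k V (U *m diag_mx l *m U^T) =
    \sum_(i < n | (i < k)%N) (M *m diag_mx l *m M^T) i i.
  exists (V^T *m U); first exact: orthmxM (orthmx_tr oV) oU.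
  by apply: eq_bigr => i _; rewrite trmx_mul trmxK !mulmxA.
pose c i := \sum_(j < n | (j < k)%N) M j i ^+ 2.
have -> : \sum_(i < n | (i < k)%N) (M *m diag_mx l *m M^T) i i =
    \sum_i c i * l 0 i.
  under [RHS]eq_bigr do rewrite mulr_suml.
  rewrite exchange_big/=; apply: eq_bigr => j _.
  by rewrite spectral_entry; apply: eq_bigr => i _; ring.
have c_ge0 i : 0 <= c i by apply: sumr_ge0 => j _; exact: sqr_ge0.
have c_le1 i : c i <= 1.
  have /matrixP/(_ i i) := orthmxC oM; rewrite !mxE eqxx => M1; rewrite -[leRHS]M1.
  rewrite /c big_mkcond; apply: ler_sum => j _; rewrite mxE -expr2.
  by case: ifP => // _; exact: sqr_ge0.
have c_sum : \sum_i c i = \sum_(i < n) (i < k)%N%:R.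
  rewrite exchange_big/= big_mkcond; apply: eq_bigr => j _; case: ifP => // _.
  have /matrixP/(_ j j) := oM; rewrite !mxE eqxx => <-.
  by apply: eq_bigr => i _; rewrite mxE expr2.
have [p [pl pr]] : exists p, (forall i : 'I_n, (i < k)%N -> p <= l 0 i) /\
    (forall i : 'I_n, (k <= i)%N -> l 0 i <= p).
  case: n l ll => [l ll|n' l ll]; first by exists 0; split => -[].
  (* The k-th largest entry; for k = 0 this is the first entry, and for k beyond the size the last
     one. *)
  exists (l 0 (inord (minn k.-1 n'))); split => i ik; apply: ll;
    have := ltn_ord i; rewrite inordK ?ltnS ?geq_minr//; lia.
rewrite -subr_ge0 /partial_sum big_mkcond -sumrB.
(* Both weightings have the same total mass, so [l] may be shifted by [p]; each summand is then a
   product of two factors of the same sign. *)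
rewrite (eq_bigr (fun i : 'I_n =>
    ((i < k)%N%:R - c i) * (l 0 i - p) + p * ((i < k)%N%:R - c i))); last first.
  by move=> i _; case: ifP => _ /=; ring.
rewrite big_split/= -mulr_sumr sumrB c_sum subrr mulr0 addr0.
apply: sumr_ge0 => i _; case: ltnP => ik /=.
  by rewrite mulr_ge0// subr_ge0// pl.
by rewrite sub0r mulNr -mulrN mulr_ge0// opprB subr_ge0 pr.
Qed.

(** The trace along [V] equals the partial sum of [m] at the second matrix and, by [ky_fan], is at
    most that of [l] at the first; the gap is bounded by the trace of the difference. *)
Lemma partial_sum_lipschitz k U V l m : orthmx U -> orthmx V -> nonincr l ->
  partial_sum k m - partial_sum k l <=
  (n * n * n)%:R * `|V *m diag_mx m *m V^T - U *m diag_mx l *m U^T|.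
Proof.
move=> oU oV ll; set X := U *m _ *m _; set Y := V *m _ *m _.
have := partial_trace_le k (Y - X) oV; apply: le_trans.
apply: le_trans (ler_norm _); rewrite lerBlDr.
rewrite -(partial_trace_spectral k m oV) -/Y.
rewrite -[Z in partial_trace k V Z <= _](subrK X Y) partial_traceD lerD2l.
exact: ky_fan.
Qed.

Lemma partial_sumS (i : 'I_n) l :
  l 0 i = partial_sum i.+1 l - partial_sum i l.
Proof.
rewrite /partial_sum [X in _ = X - _](bigD1 i)//=.
rewrite (eq_bigl (fun j : 'I_n => (j < i)%N)) ?addrK// => j.
by rewrite ltnS ltn_neqAle andbC.
Qed.

(** Sorting a spectral decomposition shows that the choice defining [eigvec] never falls back on its
    default 0. *)
Lemma eigvecP X : symmx X -> nonincr (eigvec X) /\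
  exists U, orthmx U /\ X = U *m diag_mx (eigvec X) *m U^T.
Proof.
move=> /symmx_spectral[U [l [oU XE]]]; have [s sl] := nonincr_col_perm l.
apply: (@xgetPex _ 0 [set l | nonincr l /\
  exists U, orthmx U /\ X = U *m diag_mx l *m U^T]).
exists (col_perm s l); split => //; exists (col_perm s U).
by split; [exact: orthmx_col_perm|rewrite spectral_col_perm].
Qed.

Lemma partial_sum_eigvec_lipschitz k X Y : symmx X -> symmx Y ->
  partial_sum k (eigvec Y) - partial_sum k (eigvec X) <=
  (n * n * n)%:R * `|Y - X|.
Proof.
move=> /eigvecP[lX [U [oU XE]]] /eigvecP[lY [V [oV YE]]].
by rewrite {2}XE {2}YE; exact: partial_sum_lipschitz.
Qed.

(** Each entry is a difference of two partial sums, hence the factor 2. *)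
Lemma eigvec_lipschitz X Y : symmx X -> symmx Y ->
  `|eigvec Y - eigvec X| <= (n * n * n)%:R * `|Y - X| *+ 2.
Proof.
move=> sX sY; apply: mx_norm_le => [|i j].
  by rewrite mulrn_wge0// mulr_ge0.
rewrite ord1 !mxE !partial_sumS.
have a1 := partial_sum_eigvec_lipschitz j.+1 sX sY.
have a2 := partial_sum_eigvec_lipschitz j sX sY.
have a3 := partial_sum_eigvec_lipschitz j.+1 sY sX.
have a4 := partial_sum_eigvec_lipschitz j sY sX.
rewrite distrC in a3; rewrite distrC in a4.
by rewrite ler_norml mulr2n; apply/andP; split; lra.
Qed.

(** Uniqueness of the ordered spectrum: the Lipschitz bound at distance 0 forces all partial sums to
    agree. *)
Lemma eigvec_spectral U l : orthmx U -> nonincr l ->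
  eigvec (U *m diag_mx l *m U^T) = l.
Proof.
move=> oU ll; have [le [V [oV XE]]] := eigvecP (spectral_symmx U l).
set X := U *m _ *m _ in le XE *.
have E k : partial_sum k (eigvec X) = partial_sum k l.
  have a1 := partial_sum_lipschitz k (eigvec X) oU oV ll.
  have a2 := partial_sum_lipschitz k l oV oU le.
  rewrite -XE subrr normr0 mulr0 in a1; rewrite -XE subrr normr0 mulr0 in a2.
  by apply/eqP; rewrite eq_le -subr_le0 a1 -subr_le0.
by apply/rowP => i; rewrite !partial_sumS !E.
Qed.

(** Serves for lambda(X) + t v, which may be unsorted; a symmetric function does not see the
    permutation. *)
Lemma eigvec_spectral_perm U m : orthmx U ->
  exists s : 'S_n, eigvec (U *m diag_mx m *m U^T) = col_perm s m.
Proof.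
move=> oU; have [s sm] := nonincr_col_perm m; exists s.
by rewrite -(spectral_col_perm U m s) eigvec_spectral//; exact: orthmx_col_perm.
Qed.

End OrderedSpectrum.

(** * One-sided directional derivatives of the eigenvalue vector *)

Section DirectionalDerivative.
Variables (R : realType) (n : nat).
Implicit Types (X H U : 'M[R]_n).

Lemma symmxD X H : symmx X -> symmx H -> symmx (X + H).
Proof. by rewrite /symmx /= linearD/= => -> ->. Qed.

Lemma symmxZ t X : symmx X -> symmx (t *: X).
Proof. by rewrite /symmx /= linearZ/= => ->. Qed.

Definition partial_sum_slope k X H (t : R) : R :=
  t^-1 * (partial_sum k (eigvec (X + t *: H)) - partial_sum k (eigvec X)).

(* By ky_fan, partial_sum k (eigvec Y) is the maximum over orthogonal V of the
   linear functions partial_trace k V Y, hence convex in Y. *)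
Lemma partial_sum_slope_nondecreasing k X H (s t : R) : symmx X -> symmx H ->
  0 < s -> s <= t -> partial_sum_slope k X H s <= partial_sum_slope k X H t.
Proof.
move=> sX sH s0 st; have t0 := lt_le_trans s0 st.
rewrite /partial_sum_slope ler_pdivrMl// mulrCA ler_pdivlMl//.
have [_ [V [oV sE]]] := eigvecP (symmxD sX (symmxZ s sH)).
have [tl [U [oU tE]]] := eigvecP (symmxD sX (symmxZ t sH)).
have [xl [W [oW xE]]] := eigvecP sX.
have := partial_trace_spectral k (eigvec (X + s *: H)) oV.
rewrite -sE partial_traceD partial_traceZ => <-.
have := ky_fan k oU oV tl; rewrite -tE partial_traceD partial_traceZ.
have := ky_fan k oW oV xl; rewrite -xE.
move: (partial_trace k V X) (partial_trace k V H) => a b.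
move: (partial_sum k (eigvec X)) (partial_sum k (eigvec (X + t *: H))) => x y ax aby.
(* The goal is t (a + s b - x) <= s (y - x); the gap between its sides is exactly the sum of the
   products in [h1] and [h2]. *)
have h1 : 0 <= (t - s) * (x - a) by rewrite mulr_ge0 ?subr_ge0.
have h2 : 0 <= s * (y - (a + t * b)) by rewrite mulr_ge0 ?subr_ge0// ltW.
nra.
Qed.

(** The slope is monotone in t, and the Lipschitz bound keeps it bounded below, so it tends to its
    infimum. *)
Lemma partial_sum_slope_cvg k X H : symmx X -> symmx H ->
  cvg (partial_sum_slope k X H t @[t --> 0^'+]).
Proof.
move=> sX sH.
apply: (cvgP (inf [set partial_sum_slope k X H x |
  x in [set` Interval (BRight (0 : R)) +oo%O]])).
apply: nondecreasing_at_right_cvgr => //.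
  move=> s t; rewrite !in_itv/= !andbT => s0 t0 st.
  exact: partial_sum_slope_nondecreasing.
exists (- ((n * n * n)%:R * `|H|)) => _ [t tI <-].
have {tI}t0 : 0 < t by move: tI; rewrite /= in_itv/= andbT.
have := partial_sum_eigvec_lipschitz k (symmxD sX (symmxZ t sH)) sX.
rewrite opprD addNKr normrN normrZ gtr0_norm// => h.
rewrite /partial_sum_slope ler_pdivlMl//; lra.
Qed.

(** Entry i of the quotient is the difference of the slopes for i + 1 and i, so the [lim] in
    [eigvec_dir] is a true limit. *)
Lemma eigvec_dir_cvg X H : symmx X -> symmx H ->
  t^-1 *: (eigvec (X + t *: H) - eigvec X) @[t --> 0^'+] --> eigvec_dir X H.
Proof.
move=> sX sH; pose L k := lim (partial_sum_slope k X H t @[t --> 0^'+]).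
suff h : t^-1 *: (eigvec (X + t *: H) - eigvec X) @[t --> 0^'+] -->
    (\row_(i < n) (L i.+1 - L i) : 'rV[R]_n).
  by rewrite /eigvec_dir; apply/cvg_ex; eexists; exact: h.
apply/cvgrPdist_le => e e0.
have h (i : 'I_n) : \forall t \near (0 : R)^'+,
    `|(L i.+1 - L i) - (partial_sum_slope i.+1 X H t -
                        partial_sum_slope i X H t)| <= e.
  have : (partial_sum_slope i.+1 X H t - partial_sum_slope i X H t)
      @[t --> 0^'+] --> L i.+1 - L i.
    by apply: cvgB; exact: partial_sum_slope_cvg.
  by move/cvgrPdist_le; apply.
near=> t; apply: mx_norm_le => [|i j]; first exact: ltW.
have ht : forall i : 'I_n, `|(L i.+1 - L i) -
    (partial_sum_slope i.+1 X H t - partial_sum_slope i X H t)| <= e.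
  by near: t; exact: filter_forall.
rewrite ord1 !mxE; have := ht j; rewrite /partial_sum_slope !partial_sumS.
by congr (`|_| <= _); ring.
Unshelve. all: by end_near. Qed.

End DirectionalDerivative.

(** * Comparison of two subderivatives by matching perturbations *)

Section Subderivative.
Variable R : realType.

(** Every quotient of [g] at scale min(d, e) is also a quotient of [f] at scale e, for the same t,
    so the infimum for [f] is the smaller one. *)
Lemma subderiv_le (V W : normedModType R) (A : set V) (B : set W)
    (f : V -> \bar R) (g : W -> \bar R) x w y z :
  (forall e, 0 < e -> exists2 d, 0 < d & forall t v, 0 < t < d -> B v ->
     `|v - z| < d -> exists2 u, A u /\ `|u - w| < e &
       f (x + t *: u) = g (y + t *: v)) ->
  f x = g y ->
  (subderiv A f x w <= subderiv B g y z)%E.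
Proof.
move=> fg fxgy; apply: ge_ereal_sup => _ [e /= e0 <-].
have [d d0 dP] := fg e e0.
apply: (@le_trans _ _ (ereal_inf [set r : \bar R | exists (t : R) (v : W),
    [/\ 0 < t < Num.min d e, B v, `|v - z| < Num.min d e &
        r = ((g (y + t *: v)%R - g y) * (t^-1)%:E)%E]])); last first.
  by apply: ereal_sup_ubound; exists (Num.min d e); rewrite //= lt_min d0.
apply: ereal_inf_le_tmp => _ [t [v [/andP[t0 +] Bv + ->]]].
rewrite !lt_min => /andP[td te] /andP[vd _].
have [|u [Au ue] E] := dP t v _ Bv vd; first by rewrite t0.
by exists t, u; rewrite t0 te E fxgy.
Qed.

End Subderivative.

(** * The chain rule for subderivatives of spectral functions *)

Theorem theorem3p5 (R : realType) (n : nat) (theta : 'rV[R]_n -> \bar R)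
    (X : 'M[R]_n) :
  symmetric_fun theta ->
  @symmx R n X ->
  theta (eigvec X) \is a fin_num ->
  ((elsc theta /\ econvex theta /\ subdiff theta (eigvec X) !=set0)
     \/ loc_lipschitz_rel theta (eigvec X)) ->
  forall H : 'M[R]_n, @symmx R n H ->
    subderiv (@symmx R n) (fun Y => theta (eigvec Y)) X H
    = subderiv setT theta (eigvec X) (eigvec_dir X H).
Proof.
move=> symtheta sX _ _ H sH.
have near_dir e : 0 < e -> exists2 d, 0 < d & forall t, 0 < t < d ->
    `|t^-1 *: (eigvec (X + t *: H) - eigvec X) - eigvec_dir X H| < e.
  move=> e0; have /cvgrPdist_lt/(_ e e0) := eigvec_dir_cvg sX sH.
  move=> [d /= d0 dP]; exists d => // t /andP[t0 td].
  by rewrite distrC; apply: dP => //=; rewrite sub0r normrN gtr0_norm.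
apply/eqP; rewrite eq_le; apply/andP; split; apply: subderiv_le => // e e0.
- (* A perturbation v of the direction in R^n lifts to the matrix with
     eigenvalues lambda(X) + t v in an eigenbasis of X + t H. *)
  (* Conjugation by U costs a factor n^2; adding 1 keeps [c] positive when n = 0. The two halves of
     e / c bound the distances of v and of the quotient along H from [eigvec_dir X H]. *)
  pose c : R := (n * n)%:R + 1.
  have c0 : 0 < c by rewrite ltr_wpDl.
  have ec0 : 0 < e / c / 2 by rewrite !divr_gt0.
  have [d d0 dP] := near_dir _ ec0.
  exists (Num.min d (e / c / 2)); first by rewrite lt_min d0.
  move=> t v /andP[t0]; rewrite !lt_min => /andP[td _] _ /andP[_ ve].
  have [lt [U [oU HE]]] := eigvecP (symmxD sX (symmxZ t sH)).
  pose Y := U *m diag_mx (eigvec X + t *: v) *m U^T.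
  have sY : symmx Y by exact: spectral_symmx.
  exists (t^-1 *: (Y - X)); last first.
    have [s sE] := eigvec_spectral_perm (eigvec X + t *: v) oU.
    by rewrite scalerA mulfV ?gt_eqF// scale1r addrC subrK sE symtheta.
  split; first by apply: symmxZ; apply: symmxD; rewrite // -scaleN1r; exact: symmxZ.
  have {dP} := dP t; rewrite t0 => /(_ td).
  set q := t^-1 *: _ => qd.
  have -> : t^-1 *: (Y - X) - H = U *m diag_mx (v - q) *m U^T.
    have -> : v - q = t^-1 *: ((eigvec X + t *: v) - eigvec (X + t *: H)).
      rewrite /q !scalerBr scalerDr scalerA mulVf ?gt_eqF// scale1r.
      by rewrite opprB addrCA addrA.
    rewrite [diag_mx _]linearZ/= [diag_mx _]linearB/= -scalemxAr -scalemxAl.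
    rewrite mulmxBr mulmxBl -HE -/Y.
    by rewrite opprD addrA !scalerBr scalerA mulVf ?gt_eqF// scale1r.
  have vq : `|v - q| < e / c.
    rewrite -(subrKA (eigvec_dir X H)) [ltRHS]splitr.
    by apply: le_lt_trans (ler_normD _ _) (ltrD ve _); rewrite distrC.
  have dvq : `|diag_mx (v - q)| <= `|v - q|.
    apply: mx_norm_le => // i j; rewrite mxE.
    by case: eqP => _; rewrite ?mulr0n ?normr0// mulr1n ler_mx_entry.
  have Uvq : `|U *m diag_mx (v - q) *m U^T| <= (n * n)%:R * `|diag_mx (v - q)|.
    by apply: mx_norm_le => [|i j]; [rewrite mulr_ge0|exact: orthmx_conj_entry].
  apply: le_lt_trans Uvq _.
  apply: le_lt_trans (ler_wpM2l (ler0n _ _) dvq) _.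
  rewrite ltr_pdivlMr// in vq; apply: le_lt_trans vq.
  by rewrite mulrC ler_wpM2l// lerDl.
(* Conversely, the quotient of lambda along W is itself the vector direction sought. Here [c]
   exceeds the Lipschitz constant of lambda by 1; half of e pays for replacing W by H, half for the
   limit along H. *)
- pose c : R := (n * n * n)%:R *+ 2 + 1.
  have c0 : 0 < c by rewrite ltr_wpDl// mulrn_wge0.
  have [d d0 dP] := near_dir _ (divr_gt0 e0 (ltr0Sn R 1)).
  exists (Num.min d (e / 2 / c)); first by rewrite lt_min d0 !divr_gt0.
  move=> t W /andP[t0]; rewrite !lt_min => /andP[td _] sW /andP[_ We].
  exists (t^-1 *: (eigvec (X + t *: W) - eigvec X)); last first.
    by rewrite scalerA mulfV ?gt_eqF// scale1r addrC subrK.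
  split => //; have {dP} := dP t; rewrite t0 => /(_ td) qd.
  rewrite -(subrK (eigvec (X + t *: H)) (eigvec (X + t *: W))) -addrA scalerDr.
  rewrite -addrA [ltRHS]splitr.
  apply: le_lt_trans (ler_normD _ _) (ltrD _ qd).
  rewrite normrZ gtr0_norm ?invr_gt0// ltr_pdivrMl//.
  have := eigvec_lipschitz (symmxD sX (symmxZ t sH)) (symmxD sX (symmxZ t sW)).
  move/le_lt_trans; apply; rewrite opprD addrACA subrr add0r -scalerBr normrZ.
  rewrite gtr0_norm// mulrCA -mulrnAr ltr_pM2l//.
  rewrite ltr_pdivlMr// in We; apply: le_lt_trans We.
  by rewrite -mulrnAl mulrC ler_wpM2l// lerDl.
Qed.
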